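(* Let $X_6$ denote the set of all positive real numbers $d$ for which there exists a coloring of the Euclidean plane $\mathbb{E}^2$ with six colors $1,\dots,6$ of type $(1,1,1,1,1,d)$, i.e. such that for each $i\in\{1,\dots,5\}$ no two points of color $i$ are at distance exactly $1$, and no two points of color $6$ are at distance exactly $d$. Then $X_6$ contains the closed interval $[0.354, 0.657]$.
   Context: A coloring of the plane with colors $1,\dots,n$ has coloring type $(d_1,\dots,d_n)$ if, for every $i$, no two points of color $i$ are at Euclidean distance exactly $d_i$. The set $X_6$ (the ''continuum of six-colorings'') is the set of all $d>0$ for which a six-coloring of $\mathbb{E}^2$ of type $(1,1,1,1,1,d)$ exists. *)

(* Defs.v *)
From Stdlib Require Import Reals List.
Import ListNotations.
Open Scope R_scope.

Definition plane : Type := (R * R)%type.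

Definition edist (p q : plane) : R := dist_euc (fst p) (snd p) (fst q) (snd q).

Definition coloring (n : nat) (c : plane -> nat) : Prop :=
  forall p : plane, (1 <= c p <= n)%nat.

(* The list [d] is (d_1, ..., d_n); colors are numbered from 1 but [nth] counts
   from 0, so d_i is [nth (i - 1) d 0] (the default 0 is never reached). *)
Definition has_coloring_type (c : plane -> nat) (d : list R) : Prop :=
  coloring (length d) c /\
  forall i : nat, (1 <= i <= length d)%nat ->
    forall p q : plane, c p = i -> c q = i -> edist p q <> nth (i - 1) d 0.

Definition X6 (d : R) : Prop :=
  0 < d /\
  exists c : plane -> nat, has_coloring_type c [1; 1; 1; 1; 1; d].

(* Main.v *)
(** Each of two doubly periodic tilings by convex polygons with integer vertices (in units
    of 1/1000) serves a whole range of [d]. In each, two equally colored tiles are either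
    close (all distances between them are below the forbidden ones) or apart (some direction
    separates them by more than the forbidden distances). Both conditions need only be
    tested on vertices, by convexity, and for the finitely many translates that are near.
    That the tiles cover the plane is seen row by row: between two consecutive vertex
    heights the tile edges cut the plane into cells, each lying in one tile. Boundary
    points may get the color of any tile that contains them. *)

Require Import Defs.
From Stdlib Require Import Reals List ZArith Bool Lia Lra IndefiniteDescription.
Import ListNotations.
Open Scope R_scope.

(** * Convex hulls and distances in the plane *)

(** Closing under binary mixtures lets bounds on linear forms and on distances pass from the
    vertices to the whole polygon by induction, whatever the number or order of the vertices. *)
Inductive hull (S : plane -> Prop) : plane -> Prop :=
| hull_gen p : S p -> hull S p
| hull_mix t p q : 0 <= t <= 1 -> hull S p -> hull S q ->
    hull S (t * fst p + (1 - t) * fst q, t * snd p + (1 - t) * snd q).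

Lemma hull_mono (S T : plane -> Prop) (p : plane) :
  (forall q, S q -> T q) -> hull S p -> hull T p.
Proof.
  intros ST; induction 1; [apply hull_gen; auto | apply hull_mix; auto].
Qed.

Lemma hull_linear_lt (S : plane -> Prop) (u v m : R) (p : plane) :
  (forall q, S q -> u * fst q + v * snd q < m) ->
  hull S p -> u * fst p + v * snd p < m.
Proof.
  intros HS; induction 1 as [p Hp|t p q Ht _ IHp _ IHq]; [auto|simpl].
  (* At [t = 0] strictness comes from [q] alone, otherwise already from [p]. *)
  destruct (Req_dec t 0) as [->|]; nra.
Qed.

Lemma hull_linear_le (S : plane -> Prop) (u v m : R) (p : plane) :
  (forall q, S q -> u * fst q + v * snd q <= m) ->
  hull S p -> u * fst p + v * snd p <= m.
Proof.
  intros HS; induction 1 as [p Hp|t p q Ht _ IHp _ IHq]; [auto|simpl].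
  nra.
Qed.

Definition sqdist (p q : plane) : R := (fst p - fst q)² + (snd p - snd q)².

Lemma sqdist_sym (p q : plane) : sqdist p q = sqdist q p.
Proof. unfold sqdist, Rsqr; ring. Qed.

(** Squared distance to [z] is convex: at a mixture of [p] and [q] it is the mixture of the two
    values minus [t * (1 - t) * sqdist p q]. *)
Lemma hull_sqdist_lt (S : plane -> Prop) (z : plane) (m : R) (p : plane) :
  (forall q, S q -> sqdist q z < m) -> hull S p -> sqdist p z < m.
Proof.
  intros HS; induction 1 as [p Hp|t p q Ht _ IHp _ IHq]; [auto|].
  assert (E : sqdist (t * fst p + (1 - t) * fst q, t * snd p + (1 - t) * snd q) z
    = t * sqdist p z + (1 - t) * sqdist q z - t * (1 - t) * sqdist p q)
    by (unfold sqdist, Rsqr; simpl; ring).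
  assert (0 <= sqdist p q) by (unfold sqdist; apply Rplus_le_le_0_compat; apply Rle_0_sqr).
  assert (0 <= t * (1 - t) * sqdist p q) by (apply Rmult_le_pos; nra).
  rewrite E; destruct (Req_dec t 0) as [->|]; nra.
Qed.

(** By Cauchy-Schwarz, a gap above [g] along [(u, v)] forces a distance above [g] divided by the
    norm of [(u, v)], and this is at least [h]. *)
Lemma sqdist_gt_of_projection (u v h g : R) (p q : plane) :
  0 <= g -> h² * (u² + v²) <= g² ->
  u * fst p + v * snd p + g < u * fst q + v * snd q ->
  h² < sqdist p q.
Proof.
  intros Hg Hh Hpq.
  set (x := fst q - fst p); set (y := snd q - snd p).
  assert (E : sqdist p q = x² + y²) by (unfold sqdist, x, y, Rsqr; ring).
  assert (Hd : g < u * x + v * y) by (unfold x, y; lra).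
  assert (CS : (u * x + v * y)² <= (u² + v²) * (x² + y²)).
  { assert (0 <= (u * y - v * x)²) by apply Rle_0_sqr; unfold Rsqr in *; lra. }
  assert (g² < (u * x + v * y)²) by (apply Rsqr_incrst_1; lra).
  rewrite E; apply Rnot_le_lt; intros Hle.
  assert ((u² + v²) * (x² + y²) <= (u² + v²) * h²).
  { apply Rmult_le_compat_l; [|exact Hle].
    apply Rplus_le_le_0_compat; apply Rle_0_sqr. }
  lra.
Qed.

(* Lengths are in units of 1/1000. The row [(h, seps)] describes the tiling between
   the height [h] and the height of the next row (after the last row: the first height,
   one period up). Its separators are tile edges [(p, q)] that cross the row upwards;
   the first one shifted by [(period1, 0)] closes the row. The vectors in
   [directions] are normals of lines that separate tiles of the same color. *)
Record tiling := {
  period1 : Z;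
  period2 : Z * Z;
  tiles : list (nat * list (Z * Z));
  rows : list (Z * list ((Z * Z) * (Z * Z)));
  directions : list (Z * Z)
}.

(** * Decidable tests on integer tilings *)

Local Open Scope Z_scope.

Definition shift (T : tiling) (m n : Z) (v : Z * Z) : Z * Z :=
  (fst v + m * period1 T + n * fst (period2 T), snd v + n * snd (period2 T)).

Definition range : list Z := [-2; -1; 0; 1; 2].

Definition memb (v : Z * Z) (l : list (Z * Z)) : bool :=
  existsb (fun w => (fst v =? fst w) && (snd v =? snd w)) l.

(** If the ends of both separators are vertices of one translated tile, convexity puts the whole
    cell between them into that tile. *)
Definition cell_ok (T : tiling) (s s' : (Z * Z) * (Z * Z)) : bool :=
  existsb (fun tile => existsb (fun m => existsb (fun n =>
    forallb (fun v => memb v (map (shift T m n) (snd tile)))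
      [fst s; snd s; fst s'; snd s']) range) range) (tiles T).

Definition crosses (h h' : Z) (s : (Z * Z) * (Z * Z)) : bool :=
  (snd (fst s) <=? h) && (h' <=? snd (snd s)) && (snd (fst s) <? snd (snd s)).

Fixpoint row_ok (T : tiling) (h h' : Z) (last s : (Z * Z) * (Z * Z))
    (seps : list ((Z * Z) * (Z * Z))) : bool :=
  crosses h h' s &&
  match seps with
  | [] => crosses h h' last && cell_ok T s last
  | s' :: seps' => cell_ok T s s' && row_ok T h h' last s' seps'
  end.

Fixpoint rows_ok (T : tiling) (top : Z) (rs : list (Z * list ((Z * Z) * (Z * Z))))
    : bool :=
  match rs with
  | [] => true
  | (h, seps) :: rs' =>
      match seps with
      | [] => false
      | s :: seps' =>
          row_ok T h (match rs' with [] => top | (h', _) :: _ => h' end)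
            (shift T 1 0 (fst s), shift T 1 0 (snd s)) s seps'
      end && rows_ok T top rs'
  end.

Definition cover_ok (T : tiling) : bool :=
  (0 <? period1 T) && (0 <? snd (period2 T)) &&
  match rows T with
  | [] => false
  | (h, _) :: _ => rows_ok T (h + snd (period2 T)) (rows T)
  end.

Definition close (lo : Z) (P Q : list (Z * Z)) : bool :=
  forallb (fun v => forallb (fun w =>
    (fst v - fst w) * (fst v - fst w) + (snd v - snd w) * (snd v - snd w) <? lo * lo)
    Q) P.

Definition dot (u v : Z * Z) : Z := fst u * fst v + snd u * snd v.

(** Rounding [hi] times the norm of [u] up to the integer [g] keeps the test in integers and errs on
    the safe side. The test is directed: [Q] must lie beyond [P] along [u]. *)
Definition apart (hi : Z) (P Q : list (Z * Z)) (u : Z * Z) : bool :=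
  let g := Z.sqrt_up (hi * hi * dot u u) in
  let Q' := map (dot u) Q in
  forallb (fun x => forallb (fun y => x + g <? y) Q') (map (dot u) P).

Definition pair_ok (T : tiling) (lo hi : Z) (P Q : list (Z * Z)) : bool :=
  forallb (fun m => forallb (fun n =>
    let Q' := map (shift T m n) Q in
    close lo P Q' ||
    existsb (fun u => apart hi P Q' u || apart hi Q' P u) (directions T)) range) range.

Definition bounded (b : Z) (P : list (Z * Z)) : bool :=
  forallb (fun v => (Z.abs (fst v) <=? b) && (Z.abs (snd v) <=? b)) P.

(* The bound 1350 on the coordinates of the tiles makes translates by more than two
   periods irrelevant. *)
Definition colors_ok (T : tiling) (lo hi : Z) : bool :=
  (0 <=? lo) && (hi <=? 1000) &&
  (3700 <? 3 * snd (period2 T)) &&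
  (3700 + 2 * Z.abs (fst (period2 T)) <? 3 * period1 T) &&
  forallb (fun t => (1 <=? fst t)%nat && (fst t <=? 6)%nat && bounded 1350 (snd t))
    (tiles T) &&
  forallb (fun t => forallb (fun t' =>
    negb (Nat.eqb (fst t) (fst t')) ||
    (if Nat.eqb (fst t) 6 then pair_ok T lo hi (snd t) (snd t')
     else pair_ok T 1000 1000 (snd t) (snd t'))) (tiles T)) (tiles T).

(** * Integer polygons and their translates in the real plane *)

Local Open Scope R_scope.

Definition inj (v : Z * Z) : plane := (IZR (fst v), IZR (snd v)).

Definition poly (P : list (Z * Z)) : plane -> Prop :=
  hull (fun p => exists v, In v P /\ p = inj v).

Definition move (T : tiling) (m n : Z) (p : plane) : plane :=
  (fst p + IZR m * IZR (period1 T) + IZR n * IZR (fst (period2 T)),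
   snd p + IZR n * IZR (snd (period2 T))).

Lemma poly_map_shift (T : tiling) (m n : Z) (P : list (Z * Z)) (p : plane) :
  poly P p -> poly (map (shift T m n) P) (move T m n p).
Proof.
  induction 1 as [p [v [Hv ->]]|t p q Ht _ IHp _ IHq].
  - apply hull_gen; exists (shift T m n v); split; [now apply in_map|].
    unfold move, inj, shift; simpl; rewrite !plus_IZR, !mult_IZR; reflexivity.
  - replace (move T m n _) with
      (t * fst (move T m n p) + (1 - t) * fst (move T m n q),
       t * snd (move T m n p) + (1 - t) * snd (move T m n q)).
    + now apply hull_mix.
    + unfold move; simpl; f_equal; ring.
Qed.

Lemma map_shift_shift (T : tiling) (k l m n : Z) (P : list (Z * Z)) :
  map (shift T k l) (map (shift T m n) P) = map (shift T (k + m) (l + n)) P.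
Proof.
  rewrite map_map; apply map_ext; intros v; unfold shift; simpl; f_equal; ring.
Qed.

Lemma map_shift_0 (T : tiling) (P : list (Z * Z)) : map (shift T 0 0) P = P.
Proof.
  rewrite <- (map_id P) at 2; apply map_ext; intros [x y]; unfold shift; simpl; f_equal; ring.
Qed.

Lemma poly_unshift (T : tiling) (m n : Z) (P : list (Z * Z)) (p : plane) :
  poly (map (shift T m n) P) p -> poly P (move T (- m) (- n) p).
Proof.
  intros H; apply (poly_map_shift T (- m) (- n)) in H.
  rewrite map_shift_shift, !Z.add_opp_diag_l, map_shift_0 in H; exact H.
Qed.

Lemma sqdist_move (T : tiling) (m n : Z) (p q : plane) :
  sqdist (move T m n p) (move T m n q) = sqdist p q.
Proof. unfold sqdist, move, Rsqr; simpl; ring. Qed.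

Lemma memb_In (v : Z * Z) (l : list (Z * Z)) : memb v l = true -> In v l.
Proof.
  unfold memb; rewrite existsb_exists; intros [w [Hw E]].
  apply andb_true_iff in E as [E1 E2]; apply Z.eqb_eq in E1, E2.
  destruct v, w; simpl in *; now subst.
Qed.

(** * Covering *)

Definition covered (T : tiling) (p : plane) : Prop :=
  exists t m n, In t (tiles T) /\ poly (map (shift T m n) (snd t)) p.

Lemma covered_move (T : tiling) (m n : Z) (p : plane) :
  covered T p -> covered T (move T m n p).
Proof.
  intros [t [k [l [Ht Hp]]]]; exists t, (m + k)%Z, (n + l)%Z; split; [exact Ht|].
  rewrite <- map_shift_shift; now apply poly_map_shift.
Qed.

(** The abscissa at height [y] of the line through the edge [s]. *)
Definition xat (s : (Z * Z) * (Z * Z)) (y : R) : R :=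
  let p := inj (fst s) in let q := inj (snd s) in
  fst p + (y - snd p) / (snd q - snd p) * (fst q - fst p).

Lemma poly_xat (h h' : Z) (s : (Z * Z) * (Z * Z)) (y : R) :
  crosses h h' s = true -> IZR h <= y <= IZR h' ->
  poly [fst s; snd s] (xat s y, y).
Proof.
  intros Hc Hy; unfold crosses in Hc.
  apply andb_true_iff in Hc as [Hc H3]; apply andb_true_iff in Hc as [H1 H2].
  apply Z.leb_le, IZR_le in H1, H2; apply Z.ltb_lt, IZR_lt in H3.
  destruct s as [[px py] [qx qy]]; simpl in *.
  set (t := (y - IZR py) / (IZR qy - IZR py)).
  assert (Ht : t * (IZR qy - IZR py) = y - IZR py) by (unfold t; field; lra).
  replace (xat _ y, y) with
    (t * fst (inj (qx, qy)) + (1 - t) * fst (inj (px, py)),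
     t * snd (inj (qx, qy)) + (1 - t) * snd (inj (px, py))).
  - apply hull_mix; [nra| |]; apply hull_gen; eexists; split; try reflexivity;
      simpl; auto.
  - unfold xat; simpl; fold t; f_equal; lra.
Qed.

(** The horizontal segment at height [y] between the two separators has its ends on tile edges,
    hence in the tile, and [(x, y)] is a mixture of these ends. *)
Lemma cell_covered (T : tiling) (h h' : Z) (s s' : (Z * Z) * (Z * Z)) (x y : R) :
  crosses h h' s = true -> crosses h h' s' = true -> cell_ok T s s' = true ->
  IZR h <= y <= IZR h' -> xat s y <= x <= xat s' y -> covered T (x, y).
Proof.
  intros Hs Hs' Hc Hy Hx; unfold cell_ok in Hc.
  apply existsb_exists in Hc as [t [Ht Hc]].
  apply existsb_exists in Hc as [m [_ Hc]].
  apply existsb_exists in Hc as [n [_ Hc]].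
  rewrite forallb_forall in Hc.
  exists t, m, n; split; [exact Ht|].
  apply (hull_mono (fun p => exists v, In v [fst s; snd s; fst s'; snd s'] /\ p = inj v)).
  { intros q [v [Hv ->]]; exists v; split; [apply memb_In; auto|reflexivity]. }
  assert (A : poly [fst s; snd s; fst s'; snd s'] (xat s y, y)).
  { refine (hull_mono _ _ _ _ (poly_xat _ _ _ _ Hs Hy)).
    intros q [v [Hv ->]]; exists v; split; [simpl in *; tauto|reflexivity]. }
  assert (B : poly [fst s; snd s; fst s'; snd s'] (xat s' y, y)).
  { refine (hull_mono _ _ _ _ (poly_xat _ _ _ _ Hs' Hy)).
    intros q [v [Hv ->]]; exists v; split; [simpl in *; tauto|reflexivity]. }
  destruct (Req_dec (xat s y) (xat s' y)) as [E|E].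
  { replace x with (xat s y) by lra; exact A. }
  set (t0 := (xat s' y - x) / (xat s' y - xat s y)).
  assert (Ht0 : t0 * (xat s' y - xat s y) = xat s' y - x) by (unfold t0; field; lra).
  replace (x, y) with
    (t0 * fst (xat s y, y) + (1 - t0) * fst (xat s' y, y),
     t0 * snd (xat s y, y) + (1 - t0) * snd (xat s' y, y)).
  - apply hull_mix; [nra|exact A|exact B].
  - simpl; f_equal; lra.
Qed.

(** Walk to the right along the separators until the next one is no longer to the left of [x]. *)
Lemma row_covered (T : tiling) (h h' : Z) (last s : (Z * Z) * (Z * Z))
    (seps : list ((Z * Z) * (Z * Z))) (x y : R) :
  row_ok T h h' last s seps = true ->
  IZR h <= y <= IZR h' -> xat s y <= x <= xat last y -> covered T (x, y).
Proof.
  revert s; induction seps as [|s' seps IH]; intros s H Hy Hx; simpl in H;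
    apply andb_true_iff in H as [Hs H]; apply andb_true_iff in H as [H1 H2].
  - now apply (cell_covered T h h' s last).
  - destruct (Rle_or_lt x (xat s' y)).
    + apply (cell_covered T h h' s s'); auto; [|lra].
      (* For either shape of [seps], the first conjunct of [row_ok] is the crossing test of [s']. *)
      destruct seps; simpl in H2; apply andb_true_iff in H2; tauto.
    + apply (IH s'); auto; lra.
Qed.

Lemma xat_shift (T : tiling) (s : (Z * Z) * (Z * Z)) (y : R) :
  xat (shift T 1 0 (fst s), shift T 1 0 (snd s)) y = xat s y + IZR (period1 T).
Proof.
  assert (E : forall v, shift T 1 0 v = (fst v + period1 T, snd v)%Z)
    by (intros v; unfold shift; f_equal; ring).
  rewrite !E; unfold xat, inj; cbn [fst snd]; rewrite !plus_IZR; unfold Rdiv; ring.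
Qed.

Lemma floor_exists (r : R) : exists n : Z, IZR n <= r < IZR n + 1.
Proof.
  exists (up r - 1)%Z; rewrite minus_IZR; destruct (archimed r); lra.
Qed.

Lemma covered_of_move (T : tiling) (m n : Z) (p : plane) :
  covered T (move T (- m) (- n) p) -> covered T p.
Proof.
  intros H; apply (covered_move T m n) in H; revert H.
  replace (move T m n _) with p; [easy|].
  destruct p; unfold move; simpl; rewrite !opp_IZR; f_equal; ring.
Qed.

Lemma rows_covered (T : tiling) (top : Z) (rs : list (Z * list ((Z * Z) * (Z * Z))))
    (h : Z) (seps : list ((Z * Z) * (Z * Z))) (x y : R) :
  (0 < period1 T)%Z -> rows_ok T top ((h, seps) :: rs) = true ->
  IZR h <= y <= IZR top -> covered T (x, y).
Proof.
  intros Ha; apply IZR_lt in Ha.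
  revert h seps; induction rs as [|[h' seps'] rs IH]; intros h seps H Hy;
    cbn [rows_ok] in H; apply andb_true_iff in H as [H1 H2];
    destruct seps as [|s seps]; try discriminate.
  (* The upper height [h1] stays general, to serve both the last row, bounded by [top], and a row
     followed by another. *)
  all: assert (Hrow : forall h1, row_ok T h h1 (shift T 1 0 (fst s), shift T 1 0 (snd s)) s seps
      = true -> IZR h <= y <= IZR h1 -> covered T (x, y)).
  (* Moving left by [m] periods brings the point between the first separator and its translate by
     one period. *)
  1, 3: intros h1 Hr Hh; destruct (floor_exists ((x - xat s y) / IZR (period1 T))) as [m Hm];
    apply (covered_of_move T m 0);
    unfold move; simpl; rewrite opp_IZR, !Rmult_0_l, !Rplus_0_r;
    apply (row_covered T h h1 _ s seps _ _ Hr Hh);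
    rewrite xat_shift;
    assert (E : (x - xat s y) / IZR (period1 T) * IZR (period1 T) = x - xat s y)
      by (field; lra); nra.
  - now apply (Hrow top).
  - destruct (Rle_or_lt y (IZR h')).
    + apply (Hrow h' H1); lra.
    + apply (IH h' seps' H2); lra.
Qed.

Lemma cover_ok_covered (T : tiling) (p : plane) : cover_ok T = true -> covered T p.
Proof.
  unfold cover_ok; intros H; apply andb_true_iff in H as [H H3].
  apply andb_true_iff in H as [H1 H2]; apply Z.ltb_lt in H1, H2.
  destruct (rows T) as [|[h seps] rs]; [discriminate|].
  apply IZR_lt in H2; set (c := snd (period2 T)) in *.
  (* Moving back by [n] second periods brings the point into the strip described by the rows. *)
  destruct (floor_exists ((snd p - IZR h) / IZR c)) as [n Hn].
  apply (covered_of_move T 0 n); unfold move; fold c.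
  apply (rows_covered T _ _ _ _ _ _ H1 H3).
  rewrite plus_IZR, opp_IZR.
  assert (E : (snd p - IZR h) / IZR c * IZR c = snd p - IZR h) by (field; lra); nra.
Qed.

(** * Distances between tiles of the same color *)

(** Convexity is used twice: first in [q] with [p] fixed, then in [p] with a vertex of [Q] fixed. *)
Lemma close_sqdist (lo : Z) (P Q : list (Z * Z)) (p q : plane) :
  close lo P Q = true -> poly P p -> poly Q q -> sqdist p q < (IZR lo)².
Proof.
  unfold close; rewrite forallb_forall; intros H Hp Hq.
  rewrite sqdist_sym; revert Hq; apply hull_sqdist_lt; intros q' [w [Hw ->]].
  rewrite sqdist_sym; revert Hp; apply hull_sqdist_lt; intros p' [v [Hv ->]].
  specialize (H v Hv); rewrite forallb_forall in H; specialize (H w Hw).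
  apply Z.ltb_lt, IZR_lt in H.
  rewrite plus_IZR, !mult_IZR, !minus_IZR in H; exact H.
Qed.

Lemma apart_sqdist (hi : Z) (P Q : list (Z * Z)) (u : Z * Z) (p q : plane) :
  apart hi P Q u = true -> poly P p -> poly Q q -> (IZR hi)² < sqdist p q.
Proof.
  unfold apart; set (g := Z.sqrt_up _); cbv zeta; rewrite forallb_forall; intros H Hp Hq.
  assert (Hg : (0 <= g)%Z) by apply Z.sqrt_up_nonneg.
  assert (Hh : (hi * hi * dot u u <= g * g)%Z).
  { assert (0 <= hi * hi * dot u u)%Z by (unfold dot; nia).
    (* [Z.sqrt_up_spec] asks for a positive argument; at 0 the bound is trivial. *)
    destruct (Z.eq_dec (hi * hi * dot u u) 0); [nia|].
    apply Z.sqrt_up_spec; lia. }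
  apply IZR_le in Hg, Hh; unfold dot in Hh; rewrite !mult_IZR, plus_IZR, !mult_IZR in Hh.
  apply (sqdist_gt_of_projection (IZR (fst u)) (IZR (snd u)) _ (IZR g));
    [exact Hg | exact Hh |].
  (* [hull_linear_lt] gives upper bounds, so the lower bound at [q] is stated for the opposite
     linear form. *)
  enough (- IZR (fst u) * fst q + - IZR (snd u) * snd q
    < - (IZR (fst u) * fst p + IZR (snd u) * snd p + IZR g)) by lra.
  revert Hq; apply hull_linear_lt; intros q' [w [Hw ->]].
  enough (IZR (fst u) * fst p + IZR (snd u) * snd p
    < IZR (fst u) * fst (inj w) + IZR (snd u) * snd (inj w) - IZR g) by lra.
  revert Hp; apply hull_linear_lt; intros p' [v [Hv ->]].
  specialize (H _ (in_map (dot u) _ _ Hv)); rewrite forallb_forall in H.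
  specialize (H _ (in_map (dot u) _ _ Hw)); apply Z.ltb_lt, IZR_lt in H.
  unfold dot in H; rewrite !plus_IZR, !mult_IZR in H; simpl; lra.
Qed.

Lemma Rabs_le_bounds (x b : R) : Rabs x <= b -> - b <= x <= b.
Proof. unfold Rabs; destruct (Rcase_abs x); lra. Qed.

Lemma bounded_poly (b : Z) (P : list (Z * Z)) (p : plane) :
  bounded b P = true -> poly P p -> Rabs (fst p) <= IZR b /\ Rabs (snd p) <= IZR b.
Proof.
  unfold bounded; rewrite forallb_forall; intros H Hp.
  (* The two equations single out the four unit vectors along the axes. *)
  assert (B : forall u v, u² + v² = 1 -> u * v = 0 -> u * fst p + v * snd p <= IZR b).
  { intros u v H1 H2; revert Hp; apply hull_linear_le; intros q [w [Hw ->]].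
    specialize (H w Hw); apply andb_true_iff in H as [Hx Hy].
    apply Z.leb_le, IZR_le in Hx, Hy; rewrite abs_IZR in Hx, Hy; simpl.
    apply Rabs_le_bounds in Hx, Hy; unfold Rsqr in H1.
    destruct (Rmult_integral _ _ H2) as [->| ->]; nra. }
  split; apply Rabs_le.
  - assert (A := B 1 0); assert (A' := B (-1) 0); unfold Rsqr in *; lra.
  - assert (A := B 0 1); assert (A' := B 0 (-1)); unfold Rsqr in *; lra.
Qed.

Lemma Zabs_lt3_range (m : Z) : (Z.abs m < 3)%Z -> In m range.
Proof.
  intros H; assert (m = -2 \/ m = -1 \/ m = 0 \/ m = 1 \/ m = 2)%Z by lia.
  simpl; intuition.
Qed.

(** A distance equal to [r] would be at most 1000, which leaves only the translates in [range]; for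
    these the tiles are close or apart, and [r] lies between [lo] and [hi]. *)
Lemma pair_ok_sqdist (T : tiling) (lo hi m n : Z) (P Q : list (Z * Z)) (p q : plane) (r : R) :
  (3700 < 3 * snd (period2 T))%Z ->
  (3700 + 2 * Z.abs (fst (period2 T)) < 3 * period1 T)%Z ->
  bounded 1350 P = true -> bounded 1350 Q = true -> pair_ok T lo hi P Q = true ->
  0 <= IZR lo <= r -> r <= IZR hi <= 1000 ->
  poly P p -> poly Q q -> sqdist p (move T m n q) <> r².
Proof.
  intros Hc Ha BP BQ H Hlo Hhi Hp Hq Hr.
  assert (Hle : sqdist p (move T m n q) <= 1000²) by (rewrite Hr; apply Rsqr_incr_1; lra).
  destruct (bounded_poly _ _ _ BP Hp) as [Px Py].
  destruct (bounded_poly _ _ _ BQ Hq) as [Qx Qy].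
  assert (Hx : Rabs (fst p - fst (move T m n q)) <= 1000).
  { rewrite <- (Rabs_right 1000) by lra; apply Rsqr_le_abs_0.
    assert (0 <= (snd p - snd (move T m n q))²) by apply Rle_0_sqr.
    unfold sqdist in Hle; lra. }
  assert (Hy : Rabs (snd p - snd (move T m n q)) <= 1000).
  { rewrite <- (Rabs_right 1000) by lra; apply Rsqr_le_abs_0.
    assert (0 <= (fst p - fst (move T m n q))²) by apply Rle_0_sqr.
    unfold sqdist in Hle; lra. }
  unfold move in Hx, Hy; cbn [fst snd] in Hx, Hy.
  apply Rabs_le_bounds in Px, Py, Qx, Qy, Hx, Hy.
  (* Here 3700 is 1350 + 1350 + 1000: the bounds on the two tiles plus the largest distance at
     issue. *)
  assert (Hn : (Z.abs n < 3)%Z).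
  { assert (-3700 <= n * snd (period2 T) <= 3700)%Z; [|nia].
    split; apply le_IZR; rewrite mult_IZR; lra. }
  (* With [n] at most 2 in absolute value, the skew of the second period adds at most twice its
     first coordinate. *)
  assert (Hm : (Z.abs m < 3)%Z).
  { assert (-3700 <= m * period1 T + n * fst (period2 T) <= 3700)%Z.
    { split; apply le_IZR; rewrite plus_IZR, !mult_IZR; lra. }
    assert (Z.abs (n * fst (period2 T)) <= 2 * Z.abs (fst (period2 T)))%Z
      by (rewrite Z.abs_mul; nia).
    assert (Z.abs (m * period1 T) < 3 * period1 T)%Z by lia.
    rewrite Z.abs_mul in *; nia. }
  unfold pair_ok in H; rewrite forallb_forall in H.
  specialize (H m (Zabs_lt3_range m Hm)); rewrite forallb_forall in H.
  specialize (H n (Zabs_lt3_range n Hn)).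
  apply (poly_map_shift T m n) in Hq.
  assert (Hlor : (IZR lo)² <= r²) by (apply Rsqr_incr_1; lra).
  assert (Hrhi : r² <= (IZR hi)²) by (apply Rsqr_incr_1; lra).
  apply orb_true_iff in H as [H|H].
  { assert (D := close_sqdist _ _ _ _ _ H Hp Hq); lra. }
  apply existsb_exists in H as [u [_ H]].
  apply orb_true_iff in H as [H|H].
  - assert (D := apart_sqdist _ _ _ _ _ _ H Hp Hq); lra.
  - assert (D := apart_sqdist _ _ _ _ _ _ H Hq Hp); rewrite sqdist_sym in D; lra.
Qed.

(** Only the relative translation matters: undoing the first one on both points leaves [t] in place
    and moves [t'] by [(m' - m, n' - n)]. *)
Lemma sqdist_same_color (T : tiling) (lo hi : Z) (t t' : nat * list (Z * Z))
    (m n m' n' : Z) (p q : plane) (r : R) :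
  colors_ok T lo hi = true -> In t (tiles T) -> In t' (tiles T) -> fst t = fst t' ->
  poly (map (shift T m n) (snd t)) p -> poly (map (shift T m' n') (snd t')) q ->
  (if Nat.eqb (fst t) 6 then IZR lo <= r <= IZR hi else r = 1000) ->
  sqdist p q <> r².
Proof.
  unfold colors_ok; intros H Ht Ht' Hcol Hp Hq Hr.
  apply andb_true_iff in H as [H H5]; apply andb_true_iff in H as [H H4].
  apply andb_true_iff in H as [H H3]; apply andb_true_iff in H as [H H2].
  apply andb_true_iff in H as [H0 H1].
  apply Z.leb_le, IZR_le in H0, H1; apply Z.ltb_lt in H2, H3.
  rewrite forallb_forall in H4, H5.
  assert (B := H4 t Ht); assert (B' := H4 t' Ht').
  apply andb_true_iff in B as [_ B], B' as [_ B'].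
  specialize (H5 t Ht); rewrite forallb_forall in H5; specialize (H5 t' Ht').
  rewrite <- Hcol, Nat.eqb_refl in H5; simpl in H5.
  apply poly_unshift in Hp, Hq.
  rewrite <- (sqdist_move T (- m) (- n)).
  set (p0 := move T (- m) (- n) p) in *; set (q0 := move T (- m') (- n') q) in *.
  replace (move T (- m) (- n) q) with (move T (m' - m) (n' - n) q0)
    by (unfold q0, move; simpl; rewrite !minus_IZR, !opp_IZR; f_equal; ring).
  destruct (Nat.eqb (fst t) 6).
  - apply (pair_ok_sqdist T lo hi _ _ (snd t) (snd t')); auto; lra.
  - apply (pair_ok_sqdist T 1000 1000 _ _ (snd t) (snd t')); auto; lra.
Qed.

(** * From a tiling to a coloring *)

(** After scaling by 1000, choice assigns to each point a tile with a translate containing it. The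
    distance bounds hold on closed tiles, so any selection on boundaries works. *)
Lemma X6_of_tiling (T : tiling) (lo hi : Z) (d : R) :
  cover_ok T && colors_ok T lo hi = true ->
  0 < d -> IZR lo <= 1000 * d <= IZR hi -> X6 d.
Proof.
  intros H Hd Hr; apply andb_true_iff in H as [Hcov Hcol]; split; [exact Hd|].
  set (scale := fun p : plane => (1000 * fst p, 1000 * snd p) : plane).
  destruct (functional_choice
    (fun p t => In t (tiles T) /\ exists m n, poly (map (shift T m n) (snd t)) (scale p)))
    as [f Hf].
  { intros p; destruct (cover_ok_covered T (scale p) Hcov) as [t [m [n [Ht Hp]]]].
    exists t; split; [exact Ht|now exists m, n]. }
  exists (fun p => fst (f p)); split.
  - intros p; destruct (Hf p) as [Ht _]; unfold colors_ok in Hcol.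
    apply andb_true_iff in Hcol as [Hcol _]; apply andb_true_iff in Hcol as [_ Hcol].
    rewrite forallb_forall in Hcol; specialize (Hcol _ Ht).
    apply andb_true_iff in Hcol as [Hcol _]; apply andb_true_iff in Hcol as [H1 H2].
    apply Nat.leb_le in H1, H2; simpl; lia.
  - intros i Hi p q Hpi Hqi E.
    destruct (Hf p) as [Ht [m [n Hp]]], (Hf q) as [Ht' [m' [n' Hq]]].
    set (e := nth (i - 1) [1; 1; 1; 1; 1; d] 0) in *.
    apply (sqdist_same_color T lo hi (f p) (f q) m n m' n' (scale p) (scale q) (1000 * e));
      auto; [congruence| |].
    (* Colors 1 to 5 give the value 1000, color 6 gives [1000 * d]; all other values of [i]
       contradict [Hi]. *)
    + rewrite Hpi; unfold e; simpl in Hi.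
      do 7 (destruct i as [|i]; [simpl; lia || lra|]); lia.
    + rewrite <- E; unfold edist, dist_euc, scale, sqdist; simpl.
      rewrite Rsqr_mult, Rsqr_sqrt
        by (apply Rplus_le_le_0_compat; apply Rle_0_sqr).
      unfold Rsqr; ring.
Qed.

(** * The two tilings *)

Local Open Scope Z_scope.

(* The vertices of the two tilings below come from a numerical optimization, rounded to
   multiples of 1/1000; every inequality holds with a margin of about 1/1000. *)
Definition tiling_small : tiling := {|
  period1 := 1923;
  period2 := (930, 1680);
  tiles := [
    (1%nat, [
      (-395, -332); (-901, -754); (-912, -850); (-396, -1289); (-186, -1309);
      (-4, -918); (22, -681); (-199, -310)]);
    (2%nat, [
      (-997, 762); (-1179, 371); (-1076, 228); (-392, 17); (-243, 718); (-321, 882);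
      (-752, 908)]);
    (3%nat, [
      (-901, -754); (-395, -332); (-375, -5); (-392, 17); (-1076, 228); (-1298, 50);
      (-1169, -610)]);
    (4%nat, [
      (-199, -310); (22, -681); (241, -772); (672, -798); (754, -610); (625, 50);
      (532, 90); (-91, -154)]);
    (5%nat, [
      (534, 391); (18, 830); (-243, 718); (-392, 17); (-375, -5); (-91, -154);
      (532, 90)]);
    (6%nat, [
      (-375, -5); (-395, -332); (-199, -310); (-91, -154)]);
    (6%nat, [
      (22, -681); (-4, -918); (241, -772)]);
    (6%nat, [
      (744, 371); (534, 391); (532, 90); (625, 50); (847, 228)]);
    (6%nat, [
      (672, -798); (750, -962); (1011, -850); (1022, -754); (754, -610)])];
  rows := [
    (-798, [
      ((-912, -850), (-901, -754)); ((-4, -918), (22, -681));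
      ((-4, -918), (241, -772)); ((672, -798), (241, -772)); ((672, -798), (754, -610))]);
    (-772, [
      ((-912, -850), (-901, -754)); ((-4, -918), (22, -681));
      ((241, -772), (22, -681)); ((672, -798), (754, -610))]);
    (-754, [
      ((-901, -754), (-395, -332)); ((-4, -918), (22, -681));
      ((241, -772), (22, -681)); ((672, -798), (754, -610));
      ((1022, -754), (754, -610))]);
    (-681, [
      ((-901, -754), (-395, -332)); ((22, -681), (-199, -310));
      ((672, -798), (754, -610)); ((1022, -754), (754, -610))]);
    (-610, [
      ((-901, -754), (-395, -332)); ((22, -681), (-199, -310));
      ((754, -610), (625, 50))]);
    (-332, [
      ((-395, -332), (-375, -5)); ((-395, -332), (-199, -310));
      ((22, -681), (-199, -310)); ((754, -610), (625, 50))]);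
    (-310, [
      ((-395, -332), (-375, -5)); ((-199, -310), (-91, -154)); ((754, -610), (625, 50))]);
    (-154, [
      ((-395, -332), (-375, -5)); ((-91, -154), (-375, -5)); ((-91, -154), (532, 90));
      ((754, -610), (625, 50))]);
    (-5, [
      ((-375, -5), (-392, 17)); ((-91, -154), (532, 90)); ((754, -610), (625, 50))]);
    (17, [
      ((-392, 17), (-1076, 228)); ((-392, 17), (-243, 718)); ((-91, -154), (532, 90));
      ((754, -610), (625, 50))]);
    (50, [
      ((-392, 17), (-1076, 228)); ((-392, 17), (-243, 718)); ((-91, -154), (532, 90));
      ((625, 50), (532, 90)); ((625, 50), (847, 228))]);
    (90, [
      ((-392, 17), (-1076, 228)); ((-392, 17), (-243, 718)); ((532, 90), (534, 391));
      ((625, 50), (847, 228))]);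
    (228, [
      ((-392, 17), (-243, 718)); ((532, 90), (534, 391)); ((847, 228), (744, 371))]);
    (371, [
      ((-392, 17), (-243, 718)); ((532, 90), (534, 391)); ((744, 371), (534, 391));
      ((744, 371), (926, 762))]);
    (391, [
      ((-392, 17), (-243, 718)); ((534, 391), (18, 830)); ((744, 371), (926, 762))]);
    (718, [
      ((-243, 718), (-321, 882)); ((-243, 718), (18, 830)); ((534, 391), (18, 830));
      ((744, 371), (926, 762))]);
    (762, [
      ((-997, 762), (-752, 908)); ((-243, 718), (-321, 882)); ((-243, 718), (18, 830));
      ((534, 391), (18, 830)); ((926, 762), (952, 999))]);
    (830, [
      ((-997, 762), (-752, 908)); ((-243, 718), (-321, 882)); ((18, 830), (29, 926));
      ((926, 762), (952, 999))])];
  directions := [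
    (9, -1); (3, 7); (2, 3); (10, 1); (3, 4); (5, 1); (3, -5)]
|}.

Definition tiling_large : tiling := {|
  period1 := 1995;
  period2 := (991, 1699);
  tiles := [
    (1%nat, [
      (-7, 300); (381, -229); (673, -182); (839, -24); (818, 634); (702, 716);
      (54, 593)]);
    (2%nat, [
      (7, -679); (381, -229); (-7, 300); (-241, 288); (-615, -161); (-183, -668)]);
    (3%nat, [
      (673, -182); (381, -229); (7, -679); (84, -910); (685, -1180); (943, -1025);
      (921, -367)]);
    (4%nat, [
      (-1177, 634); (-1156, -24); (-897, -204); (-615, -161); (-241, 288); (-319, 519);
      (-920, 789)]);
    (5%nat, [
      (-1074, -367); (-1052, -1025); (-937, -1106); (-289, -983); (-183, -668);
      (-615, -161); (-897, -204)]);
    (6%nat, [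
      (998, 1020); (808, 1031); (702, 716); (818, 634); (1075, 789)]);
    (6%nat, [
      (839, -24); (673, -182); (921, -367); (1098, -204)]);
    (6%nat, [
      (-241, 288); (-7, 300); (54, 593); (-61, 674); (-319, 519)])];
  rows := [
    (-679, [
      ((-289, -983), (-183, -668)); ((7, -679), (-183, -668));
      ((7, -679), (381, -229)); ((943, -1025), (921, -367))]);
    (-668, [
      ((-183, -668), (-615, -161)); ((7, -679), (381, -229));
      ((943, -1025), (921, -367))]);
    (-367, [
      ((-183, -668), (-615, -161)); ((7, -679), (381, -229));
      ((921, -367), (673, -182)); ((921, -367), (1098, -204))]);
    (-229, [
      ((-1074, -367), (-897, -204)); ((-183, -668), (-615, -161));
      ((381, -229), (-7, 300)); ((381, -229), (673, -182)); ((921, -367), (673, -182))]);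
    (-204, [
      ((-897, -204), (-1156, -24)); ((-897, -204), (-615, -161));
      ((-183, -668), (-615, -161)); ((381, -229), (-7, 300));
      ((381, -229), (673, -182)); ((921, -367), (673, -182))]);
    (-182, [
      ((-897, -204), (-1156, -24)); ((-897, -204), (-615, -161));
      ((-183, -668), (-615, -161)); ((381, -229), (-7, 300)); ((673, -182), (839, -24))]);
    (-161, [
      ((-615, -161), (-241, 288)); ((381, -229), (-7, 300)); ((673, -182), (839, -24));
      ((1098, -204), (839, -24))]);
    (-24, [
      ((-615, -161), (-241, 288)); ((381, -229), (-7, 300)); ((839, -24), (818, 634))]);
    (288, [
      ((-241, 288), (-319, 519)); ((-241, 288), (-7, 300)); ((381, -229), (-7, 300));
      ((839, -24), (818, 634))]);
    (300, [
      ((-241, 288), (-319, 519)); ((-7, 300), (54, 593)); ((839, -24), (818, 634))]);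
    (519, [
      ((-319, 519), (-920, 789)); ((-319, 519), (-61, 674)); ((-7, 300), (54, 593));
      ((839, -24), (818, 634))]);
    (593, [
      ((-319, 519), (-920, 789)); ((-319, 519), (-61, 674)); ((54, 593), (-61, 674));
      ((54, 593), (702, 716)); ((839, -24), (818, 634))]);
    (634, [
      ((-319, 519), (-920, 789)); ((-319, 519), (-61, 674)); ((54, 593), (-61, 674));
      ((54, 593), (702, 716)); ((818, 634), (702, 716)); ((818, 634), (1075, 789))]);
    (674, [
      ((-319, 519), (-920, 789)); ((-61, 674), (-83, 1332)); ((54, 593), (702, 716));
      ((818, 634), (702, 716)); ((818, 634), (1075, 789))]);
    (716, [
      ((-1177, 634), (-920, 789)); ((-319, 519), (-920, 789));
      ((-61, 674), (-83, 1332)); ((702, 716), (808, 1031))]);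
    (789, [
      ((-920, 789), (-997, 1020)); ((-61, 674), (-83, 1332)); ((702, 716), (808, 1031))])];
  directions := [
    (9, 1); (3, 4); (2, -1); (0, 1); (3, -5); (2, -5)]
|}.

Lemma tiling_small_ok : cover_ok tiling_small && colors_ok tiling_small 354 430 = true.
Proof. vm_compute; reflexivity. Qed.

Lemma tiling_large_ok : cover_ok tiling_large && colors_ok tiling_large 428 657 = true.
Proof. vm_compute; reflexivity. Qed.

Local Open Scope R_scope.

Theorem theorem1 (d : R) (hd : 0.354 <= d <= 0.657) : X6 d.
Proof.
  (* The two ranges overlap in [0.428, 0.430], so the split may be made at 0.43. *)
  destruct (Rle_or_lt d 0.43).
  - apply (X6_of_tiling tiling_small 354 430 d tiling_small_ok); lra.
  - apply (X6_of_tiling tiling_large 428 657 d tiling_large_ok); lra.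
Qed.
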